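(* Let $m\ge1$ and let $0\le a_1<\cdots<a_m$ be integers. Let $A,B$ be two independent uniformly random subsets of $[0,\lfloor a_m/2\rfloor]$. Then $$\lambda_{a_1,\dots,a_m}\ \le\ \mathbb{P}\left(a_1,\dots,a_m\notin A+B\right)^{\frac{1}{a_m+2}} ,$$ where $\mathbb{P}(a_1,\dots,a_m\notin A+B)$ is the probability that none of $a_1,\dots,a_m$ lies in $A+B$.
   Context: For integers $a\le b$, $[a,b]$ denotes the set of integers $x$ with $a\le x\le b$. For sets $X,Y$ of integers, $X+Y=\{x+y: x\in X,\,y\in Y\}$. For fixed integers $0\le a_1<\cdots<a_m$, $\lambda_{a_1,\dots,a_m}$ denotes the (unique) real number such that for all integers $k\ge0$ the probability that none of $k+a_1,\dots,k+a_m$ lies in $S+S$, where $S$ is a uniformly random subset of $[0,k+a_m]$, is bounded above and below by positive constants (depending on the $a_i$ but not on $k$) times $\lambda_{a_1,\dots,a_m}^{\,k}$; such a number exists. *)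

(* Defs.v *)
From mathcomp Require Import all_boot all_order all_algebra.
From mathcomp Require Import reals exp.

Set Implicit Arguments.
Unset Strict Implicit.
Unset Printing Implicit Defensive.

Import Order.TTheory GRing.Theory Num.Theory.
Local Open Scope ring_scope.

(* A subset of the integer interval [0, n] is an element of {set 'I_n.+1}. *)
Definition sumset (p q : nat) (X : {set 'I_p}) (Y : {set 'I_q}) : pred nat :=
  [pred z | [exists x in X, [exists y in Y, z == (x + y)%N]]].

Definition unif_prob (R : realType) (T : finType) (E : pred T) : R :=
  #|E|%:R / #|T|%:R.

Definition prob_avoid_self (R : realType) (s : seq nat) (n : nat) : R :=
  @unif_prob R {set 'I_n.+1}
    [pred S | all (fun z => z \notin sumset S S) s].

(* A pair of independent uniform random subsets is a uniform random element of
   the product type. *)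
Definition prob_avoid_indep (R : realType) (s : seq nat) (n : nat) : R :=
  @unif_prob R ({set 'I_n.+1} * {set 'I_n.+1})%type
    [pred AB | all (fun z => z \notin sumset AB.1 AB.2) s].

(* The property that characterises lambda_{a_1, ..., a_m}, where s lists
   a_1 < ... < a_m, so that a_m = last 0 s. It determines lam uniquely: since
   S = set0 avoids every z, the probabilities are positive, hence 0 < lam (take
   k = 1), and two such numbers have powers of the same order of growth. *)
Definition is_lambda (R : realType) (s : seq nat) (lam : R) : Prop :=
  exists c C : R, [/\ 0 < c, 0 < C &
    forall k : nat,
      let p := prob_avoid_self R [seq (k + z)%N | z <- s] (k + last 0%N s) in
      c * lam ^+ k <= p <= C * lam ^+ k].

(* Main.v *)
Require Import Defs.
From mathcomp Require Import all_boot all_order all_algebra.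
From mathcomp Require Import reals exp.
From mathcomp Require Import zify lra.
Import Order.TTheory GRing.Theory Num.Theory.
Local Open Scope ring_scope.

(** Write [n] for the last [a_i] and [M = n/2 + 1] (rounded down), so that [A]
    and [B] are uniformly random subsets of [[0, M - 1]], and let [P] be the
    probability that no [a_i] lies in [A + B].  Fix [T], put [k = 2 T M], and
    call [[j M, j M + M - 1]] the block of index [j]; the blocks of index at
    most [2 T] lie in [[0, k + n]] because [M - 1 <= n].  For [t < T] pair block
    [t] with block [2 T - t]: an element at offset [u] of the first and one at
    offset [v] of the second add up to [k + u + v].  Hence, if no [k + a_i] lies
    in [S + S], then for each [t] the traces of [S] on the two blocks of the
    pair, moved to [[0, M - 1]], have no [a_i] in their sumset.  The [2 T]
    blocks are disjoint, so for a random [S] these [T] pairs of traces are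
    independent, each distributed like [(A, B)].  The probability that [S + S]
    avoids all [k + a_i] is therefore at most [P ^ T] ([prob_avoid_self_le]).

    That probability is also at least [c lam ^ k] with [c > 0] independent of
    [T].  Letting [T] tend to infinity removes the constant:
    [lam ^ (2 M) <= P] ([ler_of_scaled_powers]).  Finally [2 M <= n + 2] and
    [0 < P <= 1], so [lam <= P ^ (1 / (2 M)) <= P ^ (1 / (n + 2))]. *)

(** Counting form of the independence of traces on disjoint blocks: [S] is
    determined by its traces on the [2 T] blocks, encoded by the single
    injection [g], together with its part outside the blocks. *)
Lemma card_block_traces (J : finType) (T M : nat)
    (g : 'I_T * bool * 'I_M -> J) (F : pred ({set 'I_M} * {set 'I_M}))
    (E : pred {set J}) :
  injective g ->
  (forall S, E S -> forall t,
     F ([set u | g (t, false, u) \in S], [set u | g (t, true, u) \in S])) ->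
  (#|E| <= #|F| ^ T * 2 ^ (#|J| - T * 2 * M))%N.
Proof.
move=> g_inj EF.
pose tr (S : {set J}) := [ffun t : 'I_T =>
  ([set u | g (t, false, u) \in S], [set u | g (t, true, u) \in S])].
pose h (S : {set J}) := (tr S, S :\: [set g i | i in predT]).
have h_inj : injective h.
  move=> S S' [/ffunP trE restE]; apply/setP=> x.
  have [/imsetP[[[t b] u] _ ->]|xNg] := boolP (x \in [set g i | i in predT]).
    have:= trE t; rewrite !ffunE => -[/setP/(_ u) + /setP/(_ u)].
    by rewrite !inE; case: b.
  by move/setP/(_ x): restE; rewrite !inE xNg.
rewrite -(card_image h_inj).
(* [S |-> h S] takes values in families of [T] elements of [F] times subsets
   of the complement of the blocks. *)
have -> : (#|F| ^ T = #|ffun_on F : pred {ffun 'I_T -> _}|)%N.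
  by rewrite card_ffun_on card_ord.
have -> : (#|J| - T * 2 * M = #|~: [set g i | i in predT]|)%N.
  by rewrite cardsCs setCK card_imset // !card_prod !card_ord card_bool.
rewrite -card_powerset -cardX; apply: subset_leq_card.
apply/subsetP=> _ /imageP[S ES ->]; rewrite !inE subDset setUCr subsetT andbT.
by apply/ffun_onP=> t; rewrite ffunE; apply: EF.
Qed.

(** The block paired with block [t] has index [2 T - t]; this is injective on
    the pairs [(t, side)] because [t < T < 2 T - t]. *)
Definition block_index (T t : nat) (b : bool) : nat :=
  if b then (2 * T - t)%N else t.

Lemma block_position_inj (T M t t' u u' : nat) (b b' : bool) :
  (t < T)%N -> (t' < T)%N -> (u < M)%N -> (u' < M)%N ->
  (block_index T t b * M + u = block_index T t' b' * M + u')%N ->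
  (t, b, u) = (t', b', u').
Proof.
move=> tT t'T uM u'M E.
have M0 : (0 < M)%N by apply: leq_ltn_trans uM.
have /eqP := congr1 (divn^~ M) E.
rewrite !divnMDl // !divn_small // !addn0 => /eqP jE.
have uE : u = u' by move: E; rewrite jE; lia.
have [-> ->] : t = t' /\ b = b'.
  by move: jE; rewrite /block_index; case: (b); case: (b') => *; split=> //; lia.
by rewrite uE.
Qed.

Lemma prob_avoid_self_le (R : realType) (s : seq nat) (n T : nat) :
  prob_avoid_self R [seq (T * 2 * n./2.+1 + z)%N | z <- s]
    (T * 2 * n./2.+1 + n) <= prob_avoid_indep R s n./2 ^+ T.
Proof.
rewrite /prob_avoid_self /prob_avoid_indep /unif_prob.
set M := n./2.+1; set N := (_ + n)%N.
set E := [pred S : {set 'I_N.+1} | _]; set F := [pred AB | _].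
have pos_lt (t : 'I_T) b (u : 'I_M) : (block_index T t b * M + u < N.+1)%N.
  have Mn : (M <= n.+1)%N by rewrite /M; lia.
  have jle : (block_index T t b <= T * 2)%N.
    by have := ltn_ord t; rewrite /block_index; case: b; lia.
  have := leq_mul jle (leqnn M); have := ltn_ord u; rewrite /N; lia.
pose g (i : 'I_T * bool * 'I_M) : 'I_N.+1 := Ordinal (pos_lt i.1.1 i.1.2 i.2).
have g_inj : injective g.
  move=> [[t b] u] [[t' b'] u'] /(congr1 val) /=.
  move/block_position_inj => /(_ (ltn_ord _) (ltn_ord _) (ltn_ord _) (ltn_ord _)).
  by case=> /val_inj-> -> /val_inj->.
have EF S : E S -> forall t,
    F ([set u | g (t, false, u) \in S], [set u | g (t, true, u) \in S]).
  move=> /allP avoid t; apply/allP=> z sz.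
  apply: contra (avoid _ (map_f _ sz)).
  case/existsP=> u /andP[]; rewrite inE => uS.
  case/existsP=> v /andP[]; rewrite inE => vS /eqP ->.
  (* The offsets [u] and [v] add up to [z]: their positions in the paired
     blocks [t] and [2 T - t] then add up to [k + z]. *)
  apply/existsP; exists (g (t, false, u)); rewrite uS /=.
  apply/existsP; exists (g (t, true, v)); rewrite vS /=; apply/eqP.
  rewrite [LHS]/= /block_index mulnBl.
  have := leq_mul (ltnW (ltn_ord t)) (leqnn M); lia.
have cE := card_block_traces _ _ _ _ _ _ g_inj EF.
have card_sets (U : finType) : (#|{set U}| = 2 ^ #|U|)%N.
  by rewrite -[LHS]cardsT -powersetT card_powerset cardsT.
rewrite card_prod !card_sets !card_ord -expnD addnn -mul2n.
have split_dim : (2 ^ N.+1 = (2 ^ (2 * M)) ^ T * 2 ^ (N.+1 - T * 2 * M))%N.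
  by rewrite -expnM -expnD; congr (_ ^ _)%N; rewrite /N; lia.
rewrite ler_pdivrMr ?ltr0n ?expn_gt0 //.
rewrite expr_div_n split_dim natrM (natrX _ _ T) mulrA.
rewrite divfK; last by rewrite expf_neq0 // pnatr_eq0 expn_eq0.
by rewrite -natrX -natrM ler_nat; move: cE; rewrite card_ord.
Qed.

(** A constant factor is negligible against geometric growth: by Bernoulli,
    [(x / y) ^ T] is unbounded when [y < x]. *)
Lemma ler_of_scaled_powers (R : archiRealFieldType) (c x y : R) :
  0 < c -> 0 < y -> (forall T : nat, c * x ^+ T <= y ^+ T) -> x <= y.
Proof.
move=> c0 y0 H; rewrite leNgt; apply/negP=> yx.
pose d := x / y - 1.
have d0 : 0 < d by rewrite subr_gt0 ltr_pdivlMr // mul1r.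
have bernoulli T : 1 + T%:R * d <= (1 + d) ^+ T.
  elim: T => [|T IH]; first by rewrite mul0r addr0 expr0.
  rewrite exprS; apply: le_trans (ler_wpM2l _ IH); last by lra.
  by rewrite -natr1; have := ler0n R T; nra.
have bounded T : c * (1 + T%:R * d) <= 1.
  apply: le_trans (ler_wpM2l (ltW c0) (bernoulli T)) _.
  rewrite /d subrKC expr_div_n mulrA ler_pdivrMr ?exprn_gt0 // mul1r.
  exact: H.
have cd0 : 0 < c * d by rewrite mulr_gt0.
have := Num.Theory.archi_boundP (ltW (divr_gt0 ltr01 cd0)).
set T := Num.bound _; rewrite ltr_pdivrMr // => big.
by have := bounded T; nra.
Qed.

Lemma prob_avoid_indep_gt0 (R : realType) (s : seq nat) (n : nat) :
  0 < prob_avoid_indep R s n.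
Proof.
rewrite /prob_avoid_indep /unif_prob divr_gt0 // ltr0n; apply/card_gt0P.
  exists (set0, set0); apply/allP=> z _.
  by apply/existsP=> -[u]; rewrite inE.
by exists (set0, set0).
Qed.

Lemma prob_avoid_indep_le1 (R : realType) (s : seq nat) (n : nat) :
  prob_avoid_indep R s n <= 1.
Proof.
rewrite /prob_avoid_indep /unif_prob ler_pdivrMr ?mul1r ?ler_nat ?max_card //.
by rewrite ltr0n; apply/card_gt0P; exists (set0, set0).
Qed.

Theorem theorem1p8 (R : realType) (m : nat) (a : m.-tuple nat) (lam : R)
    (hm : (1 <= m)%N) (ha : sorted ltn a) (hlam : is_lambda a lam) :
  lam <= prob_avoid_indep R a (last 0%N a)./2
           `^ (1 / ((last 0%N a)%:R + 2)).
Proof.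
have [c [C [c0 _ bounds]]] := hlam.
set n := last 0%N a in bounds *; set P := prob_avoid_indep R a n./2.
have P0 : 0 < P := prob_avoid_indep_gt0 R a n./2.
have P1 : P <= 1 := prob_avoid_indep_le1 R a n./2.
have [lam0|lam_gt0] := leP lam 0; first exact: le_trans lam0 (powR_ge0 _ _).
have powP : lam ^+ (2 * n./2.+1) <= P.
  apply: (ler_of_scaled_powers _ _ _ _ c0 P0) => T.
  rewrite -exprM mulnC mulnA.
  have /andP[lb _] := bounds (T * 2 * n./2.+1)%N.
  exact: le_trans lb (prob_avoid_self_le R a n T).
have M0 : (0 : R) < (2 * n./2.+1)%:R by rewrite ltr0n.
have lamE : lam = (lam ^+ (2 * n./2.+1)) `^ (2 * n./2.+1)%:R^-1.
  by rewrite -powR_mulrn ?ltW // -powRrM divff ?lt0r_neq0 // powRr1 ?ltW.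
rewrite lamE; apply: le_trans (_ : P `^ (2 * n./2.+1)%:R^-1 <= _).
  apply: ge0_ler_powR powP; rewrite ?invr_ge0 ?ler0n ?nnegrE //.
    by rewrite exprn_ge0 ?ltW.
  exact: ltW.
apply: ger_powR; rewrite ?P0 //.
rewrite div1r -(natrD R n 2) lef_pV2 ?posrE ?ltr0n ?addn2 // ler_nat; lia.
Qed.
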